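(* Let $\pi=\{2,3\}$, let $L=\operatorname{GL}_3(2)$, let $V$ be the natural $3$-dimensional $\mathbb{F}_2L$-module, and let $V^*$ be its contragredient (dual) module. Let $G=(V\oplus V^* )\rtimes L$ be the natural semidirect product, and let $S$ be a $2$-Sylow subgroup of $G$. Then $S$ is $\pi$-submaximal in $G$, but the image of $S$ under the canonical epimorphism $G\to G/V^*$ (whose kernel $V^*$ is an abelian $\pi$-group) is not $\pi$-submaximal in $G/V^*$.
   Context: All groups are finite. For a set of primes $\pi$, a $\pi$-subgroup of a finite group is a subgroup whose order is divisible only by primes in $\pi$. A subgroup is $\pi$-maximal if it is a $\pi$-subgroup and is not contained in a strictly larger $\pi$-subgroup. A subgroup $H$ of a finite group $G$ is $\pi$-submaximal in $G$ if there exists a finite group $G^*$ into which $G$ can be embedded as a subnormal subgroup (identify $G$ with its image) such that $H=G\cap K$ for some $\pi$-maximal subgroup $K$ of $G^*$. *)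

(* Defs.v *)
From HB Require Import structures.
From mathcomp Require Import all_boot all_order all_fingroup all_algebra.
From mathcomp Require Import all_solvable all_field all_character.

Set Implicit Arguments.
Unset Strict Implicit.
Unset Printing Implicit Defensive.

Import GRing.Theory GroupScope.

Definition pi_maximal (pi : nat_pred) (gT : finGroupType)
    (G K : {group gT}) : bool :=
  [max K | pi.-subgroup(G) K].

(* The overgroup may live in any finite group type; G is identified with its  *)
(* image under the embedding f.                                               *)
Definition pi_submaximal (pi : nat_pred) (gT : finGroupType)
    (G H : {group gT}) : Prop :=
  H \subset G /\
  exists (rT : finGroupType) (Gs : {group rT}) (f : {morphism G >-> rT})
         (K : {group rT}),
    [/\ 'injm f, f @* G <|<| Gs, pi_maximal pi Gs K & f @* H = f @* G :&: K].

Section Contragredient.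

Variables (F : fieldType) (gT : finGroupType) (G : {group gT}) (n : nat).
Variable rG : mx_representation F G n.

(* Group elements act on row vectors from the right, so the functional        *)
(* v |-> v *m w^T is sent by x to v |-> (v *m rG x^-1) *m w^T, i.e. the row   *)
(* vector w is sent to w *m (rG x^-1)^T.                                      *)
Definition contragredient_mx (x : gT) : 'M[F]_n := ((rG x^-1%g)^T)%R.

Fact contragredient_mx_repr : mx_repr G contragredient_mx.
Proof.
split=> [|x y Gx Gy]; rewrite /contragredient_mx.
  by rewrite invg1 repr_mx1 trmx1.
by rewrite invMg repr_mxM ?groupV // trmx_mul.
Qed.

Canonical contragredient_repr := MxRepresentation contragredient_mx_repr.

End Contragredient.

(* GLrepr F n is the natural representation of 'GL_n.+1[F] on row vectors.    *)
Definition natural_repr : mx_representation 'F_2 'GL_3(2) 3 := GLrepr 'F_2 2.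

(* V (+) V^*, acting on 'rV_(3 + 3): the first three coordinates are V and    *)
(* the last three are V^*.                                                    *)
Definition double_repr : mx_representation 'F_2 'GL_3(2) (3 + 3) :=
  dadd_grepr (Representation natural_repr)
             (Representation (contragredient_repr natural_repr)).

Definition semidirectT : finGroupType := sdprod_by ('MR double_repr)%gact.

Definition semidirectG : {group semidirectT} := [set: semidirectT]%G.

Definition dualV : {group semidirectT} :=
  (sdpair1 ('MR double_repr)%gact @*
     rowg (row_mx 0 1%:M : 'M['F_2]_(3, 3 + 3))%R)%G.

Definition pi23 : nat_pred := pred2 2 3.

(* Main.v *)
Require Import Defs.
From mathcomp Require Import all_boot all_order all_fingroup all_algebra.
From mathcomp Require Import all_solvable all_field all_character.

(* Write U = V (+) V^*. Inverse transposition of matrices, together with the  *)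
(* exchange of V and V^*, is an automorphism of G; let G^* be the extension   *)
(* of G by this involution. A Sylow 2-subgroup K of G^* containing S meets G  *)
(* in S, and K is pi-maximal: a larger pi-subgroup H would have index 7, so   *)
(* every cyclic subgroup of order 8 modulo U meets each conjugate of H in     *)
(* index at most 4; since G^* / U has an element of order 8, the core of H    *)
(* covers a nontrivial normal subgroup of the simple group G / U, hence all   *)
(* of it, contradicting 7 not dividing |H|.                                   *)
(*   Over X = G / V^* = V L no such twist exists. If X is subnormal in X^* and *)
(* R = O_2(X^* ), then X / (X :&: R) = L is a simple subnormal subgroup of    *)
(* X^* / R, and whatever normalises X R normalises X, hence acts on V, where  *)
(* L already induces the whole of Aut V. So the normaliser of X R induces     *)
(* only inner automorphisms on L, and a pi-maximal subgroup of X^* / R then   *)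
(* meets L in a pi-maximal subgroup of L, because the pi-subgroups of the     *)
(* commuting conjugates of L can be enlarged simultaneously. A Sylow          *)
(* 2-subgroup of L is not pi-maximal: it lies in a point stabiliser, of       *)
(* order 24.                                                                  *)

(** What separates [G] from [G / V^*] is the outer automorphism of [GL_3(2)]. A Sylow 2-subgroup of
    [GL_3(2)] lies in a point stabiliser and in a line stabiliser, both of order 24, and inverse
    transposition interchanges the two kinds. On [G] it extends to [twist]. [exists_twist_GL] yields
    an element of the extension whose fourth power lies outside [U] and whose eighth power is
    trivial; [gcore_expg4] and [pi_maximal_of_Sylow2] deduce that no larger pi-subgroup contains a
    Sylow 2-subgroup.

    For [X = G / V^*] subnormal in [Y], [affine_norm_overgroup] recovers [X] from [X <*> 'O_2(Y)] as
    the subgroup generated by elements of odd order. Since [X] already induces all automorphisms of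
    its normal subgroup [W] of order 8, only inner automorphisms of [X / W] arise in [Y / 'O_2(Y)]
    ([affine_norm_quotient_inner]). By [sub_pi_maximal_of_inner], a pi-maximal subgroup meeting [X]
    in a Sylow 2-subgroup would contain the centraliser of a vector, which is too large. *)

Set Implicit Arguments.
Unset Strict Implicit.
Unset Printing Implicit Defensive.

Import GRing.Theory GroupScope.

(** * Simplicity of a group of order 168 acting faithfully on 7 points *)

Section Simple168.
Variables (gT : finGroupType) (L A : {group gT}).
Hypotheses (oL : #|L| = 168) (sAL : A \subset L) (iA : #|L : A| = 7).
Hypothesis coreA : gcore A L = 1.

Lemma normal_not_sub (N : {group gT}) : N <| L -> N :!=: 1 -> ~~ (N \subset A).
Proof.
move=> /andP[_ nNL] ntN; apply: contra ntN => sNA.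
by rewrite -subG1 -coreA gcore_max.
Qed.

(** [A] has prime index, so it is maximal in [L], and [N] is not inside it. *)
Lemma normal_cover (N : {group gT}) : N <| L -> N :!=: 1 -> N * A = L.
Proof.
move=> nsNL ntN; have nNA : A \subset 'N(N) by apply: subset_trans sAL (normal_norm nsNL).
have sNAL : N <*> A \subset L by rewrite join_subG (normal_sub nsNL).
have := indexg_gt1; rewrite -norm_joinEr //.
have sA : A \subset N <*> A by apply: joing_subr.
have := Lagrange_index sNAL sA; rewrite iA => e.
have: #|N <*> A : A| \in divisors 7 by rewrite -dvdn_divisors // -e dvdn_mull.
rewrite !inE => /orP[] /eqP e1 _.
  case/negP: (normal_not_sub nsNL ntN).
  have /eqP := e1; rewrite indexg_eq1 => /(subset_trans _); apply; exact: joing_subl.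
apply/eqP; rewrite eqEsubset sNAL -indexg_eq1.
by move: e; rewrite e1 => /eqP; rewrite -[X in _ == X]mul1n eqn_pmul2r.
Qed.

Lemma normal_index (N : {group gT}) : N <| L -> N :!=: 1 -> (#|N| = 7 * #|N :&: A|)%N.
Proof.
move=> nsNL ntN; have := mul_cardG N A; rewrite normal_cover //.
have oA : #|A| = 24.
  by apply/eqP; rewrite -(@eqn_pmul2r 7) // -{1}iA Lagrange // oL.
by rewrite oL oA => e; apply/eqP; rewrite -(@eqn_pmul2r 24) // e mulnAC.
Qed.

(** If [Q] were normal, its centraliser would have index dividing [#|Aut Q| = 6]. It would meet [A]
    in a subgroup normalised by [Q * A = L], hence trivially, so its order would be 7 and its index
    24. *)
Lemma Syl7_not_normal (Q : {group gT}) : #|Q| = 7 -> ~~ (Q <| L).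
Proof.
move=> oQ; apply/negP => nsQL.
have ntQ : Q :!=: 1 by rewrite -cardG_gt1 oQ.
have nsCL : 'C_L(Q) <| L.
  by have := subcent_normal L Q; rewrite (setIidPl (normal_norm nsQL)).
have cQ : cyclic Q by apply: prime_cyclic; rewrite oQ.
have iC : #|L : 'C_L(Q)| %| 6.
  have <- : #|Aut Q| = 6 by rewrite card_Aut_cyclic ?oQ.
  have := cardSg (Aut_conj_aut Q L); rewrite card_morphim ker_conj_aut.
  by rewrite (setIidPr (normal_norm nsQL)) -indexgI.
have TI : 'C_L(Q) :&: A = 1.
  apply/eqP; rewrite -subG1 -coreA gcore_max ?subsetIr //.
  rewrite -(normal_cover nsQL ntQ) mul_subG //.
    apply: cents_norm; rewrite centsC.
    by apply: subset_trans (subsetIl _ _) (subsetIr _ _).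
  by rewrite normsI ?normG // (subset_trans sAL) // normal_norm.
have ntC : 'C_L(Q) != 1.
  apply: contraTneq iC => ->; rewrite indexg1 oL; by [].
have := normal_index nsCL ntC; rewrite TI cards1 => oC.
by have := Lagrange (normal_sub nsCL); rewrite oL oC; move: iC; case: #|_ : _| => [|[|[|[|[|[|[|?]]]]]]].
Qed.

Lemma card_elts_order7 (N : {group gT}) : #|N| = 56 -> #|'Syl_7(N)| = 8 ->
  48 <= #|[set x in N | #[x] == 7]|.
Proof.
move=> oN nS; have l7 : (56`_7)%N = 7 by rewrite p_part.
rewrite -sum1_card.
rewrite (partition_big (fun x => <[x]>%G) (mem 'Syl_7(N))) /=; last first.
  move=> x; rewrite !inE => /andP[Nx /eqP ox].
  by rewrite pHallE cycle_subG Nx -orderE ox oN /= l7.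
apply: leq_trans (_ : \sum_(P in 'Syl_7(N)) 6 <= _).
  by rewrite sum_nat_const nS.
apply: leq_sum => P; rewrite inE => sylP.
have oP : #|P| = 7 by rewrite (card_Hall sylP) oN l7.
have oP1 : #|P^#| = 6 by move: oP; rewrite (cardsD1 1 P) group1 => -[].
rewrite sum1_card -[leqLHS]oP1; apply/subset_leq_card/subsetP => x /setD1P[ntx Px].
have ox : #[x] = 7.
  have : #[x] \in divisors 7 by rewrite -dvdn_divisors // -oP order_dvdG.
  by rewrite !inE order_eq1 (negPf ntx) => /eqP.
rewrite unfold_in /= inE ox eqxx (subsetP (pHall_sub sylP)) //=.
by rewrite -val_eqE eqEcard /= cycle_subG Px oP -orderE ox.
Qed.

(** A nontrivial normal [N] contains all eight Sylow 7-subgroups, so 56 divides its order. If the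
    order is 56, only 8 elements of [N] do not have order 7; they make up every [L]-conjugate of
    [N :&: A], which is then normal in [L] and lies in the trivial core. *)
Lemma simple168 : simple L.
Proof.
apply/simpleP; split=> [|N nsNL]; first by rewrite -cardG_gt1 oL.
case: (eqVneq (N : {set gT}) 1) => [-> | ntN]; [by left | right].
have oN := normal_index nsNL ntN.
have l7 : (168`_7)%N = 7 by rewrite p_part.
have dN : #|N| %| 168 by rewrite -oL cardSg ?normal_sub.
have sSyl (Q : {group gT}) : 7.-Sylow(L) Q -> 7.-Sylow(N) Q.
  move=> sylQ; have sylNQ := Sylow_setI_normal nsNL sylQ.
  suff <- : (N :&: Q)%G = Q by [].
  apply/eqP; rewrite -val_eqE /= eqEcard subsetIr (card_Hall sylQ) oL l7.
  rewrite (card_Hall sylNQ) oN p_part; apply: (@leq_pexp2l 7 1) => //.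
  by rewrite logn_gt0 mem_primes -oN cardG_gt0 oN dvdn_mulr.
have leS : #|'Syl_7(L)| <= #|'Syl_7(N)|.
  by apply/subset_leq_card/subsetP => Q; rewrite !inE; apply: sSyl.
have nL1 : #|'Syl_7(L)| != 1%N.
  apply/negP => /normal_sylowP[Q sylQ].
  by apply/negP/Syl7_not_normal; rewrite (card_Hall sylQ) oL.
have nN (M : {group gT}) : #|M| %| 168 -> #|'Syl_7(M)| \in [:: 1%N; 8].
  move=> dM; have := card_Syl_mod M (isT : prime 7).
  have: #|'Syl_7(M)| \in divisors 168.
    by rewrite -dvdn_divisors // (dvdn_trans (card_Syl_dvd _ _)).
  (* Among the divisors of 168, only 1 and 8 are congruent to 1 modulo 7. *)
  by rewrite (_ : divisors 168 = [:: 1%N; 2; 3; 4; 6; 7; 8; 12; 14; 21; 24; 28; 42; 56; 84; 168]) //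
    !inE; do 15![case/orP; first by move/eqP=> ->]; move/eqP=> ->.
have nL8 : #|'Syl_7(L)| = 8.
  by have := nN L; rewrite oL => /(_ isT); rewrite !inE (negPf nL1) => /eqP.
have nN8 : #|'Syl_7(N)| = 8.
  by have := nN N dN; rewrite !inE => /orP[] /eqP e //; move: leS; rewrite nL8 e.
have d56 : 56 %| #|N|.
  rewrite (_ : 56 = 7 * 8)%N // Gauss_dvd // {1}oN dvdn_mulr //.
  by rewrite -nN8 card_Syl_dvd.
apply/eqP; rewrite eqEcard normal_sub // oL.
case/dvdnP: d56 => k e; move: dN; rewrite e (_ : 168 = 3 * 56)%N // dvdn_pmul2r // leq_pmul2r //.
case: k e => [|[|[|k]]] // e _; exfalso.
set E := [set x in N | #[x] == 7].
have cE : 48 <= #|E| by apply: card_elts_order7.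
have oNA : #|N :&: A| = 8 by apply/eqP; rewrite -(eqn_pmul2l (isT : 0 < 7)) -oN e.
have sD (l : gT) : l \in L -> (N :&: A) :^ l = N :\: E.
  move=> Ll; apply/eqP; rewrite eqEcard cardJg oNA; apply/andP; split.
    apply/subsetP => x Ax; have Nx : x \in N.
      by rewrite -(normsP (normal_norm nsNL) l Ll); apply: subsetP Ax; rewrite conjSg subsetIl.
    rewrite !inE Nx !andbT; apply/negP => /eqP ox.
    by have := order_dvdG Ax; rewrite cardJg oNA ox.
  rewrite -(leq_add2l #|N :&: E|) cardsID (setIidPr _) ?e; last first.
    by apply/subsetP => x; rewrite inE => /andP[].
  by rewrite (leq_trans _ (leq_add cE (leqnn 8))).
have: N :&: A \subset gcore A L.
  apply: gcore_max (subsetIr _ _) _; apply/subsetP => l Ll.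
  by rewrite inE sD // -(sD 1) ?conjsg1.
by rewrite coreA subG1 => /eqP tI; move: oNA; rewrite tI cards1.
Qed.

Lemma simple168_nonabelian : ~~ abelian L.
Proof.
apply/negP => abL; have nsAL : A <| L by rewrite -sub_abelian_normal.
case: (eqVneq (A : {set gT}) 1) => [A1 | /(normal_not_sub nsAL)]; last by rewrite subxx.
by have := Lagrange sAL; rewrite A1 cards1 -{1}A1 iA oL.
Qed.
End Simple168.

(** * Simple subnormal subgroups and pi-maximal subgroups *)

Section Components.
Variable gT : finGroupType.
Implicit Types Y L N K A H : {group gT}.

Lemma simple_perfect L : simple L -> ~~ abelian L -> [~: L, L] = L.
Proof.
move=> /simpleP[ntL simL] nabL; case: (simL _ (der_normal 1 L)) => //= L'1.
by case/negP: nabL; apply/commG1P; rewrite -derg1.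
Qed.

(** Induction through a proper normal [M] containing [L]. If [L] is not inside [N :&: M], this
    intersection centralises [L] and contains [[~: N, L]]; the three subgroups lemma and perfectness
    of [L] give [[~: N, L] = 1]. *)
Lemma subnormal_simple_sub_or_cent Y L N :
  L <|<| Y -> simple L -> ~~ abelian L -> N <| Y -> L \subset N \/ N \subset 'C(L).
Proof.
move=> snLY simL nabL; have [n leY] := ubnP #|Y|.
elim: n => // n IHn in Y N leY snLY *; move=> nsNY.
case: (subnormalEr snLY) => [eLY | [M [snLM nsMY prMY]]].
  case/simpleP: simL => _ simL; rewrite -eLY in nsNY.
  by case: (simL _ nsNY) => ->; [right; apply: sub1G | left].
have nsNM : N :&: M <| M by rewrite setIC (normalGI (normal_sub nsMY) nsNY).
have ltM : #|M| < n by apply: leq_trans (proper_card prMY) _; rewrite -ltnS.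
case: (IHn M _ ltM snLM nsNM) => [|cNML]; first by rewrite subsetI => /andP[]; left.
right; have sLM := subnormal_sub snLM.
have cNL : [~: N, L] \subset 'C(L).
  apply: subset_trans (commgS _ sLM) _; apply: subset_trans cNML.
  have nMN : N \subset 'N(M) := subset_trans (normal_sub nsNY) (normal_norm nsMY).
  have nNM : M \subset 'N(N) := subset_trans (normal_sub nsMY) (normal_norm nsNY).
  by rewrite subsetI commg_subl nNM commg_subr.
have NLL : [~: N, L, L] = 1 by apply/commG1P.
have: [~: L, L, N] = 1 by apply: three_subgroup => //; rewrite [[~: L, N]]commGC.
by rewrite simple_perfect // commGC => /commG1P.
Qed.

Lemma subnormal_simple_eq_or_cent Y L1 L2 :
    L1 <|<| Y -> simple L1 -> ~~ abelian L1 ->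
    L2 <|<| Y -> simple L2 -> ~~ abelian L2 ->
  L1 :=: L2 \/ L1 \subset 'C(L2).
Proof.
move=> + simL1 nab1 + simL2 nab2; have [n leY] := ubnP #|Y|.
elim: n => // n IHn in Y leY *; move=> sn1 sn2.
case: (subnormalEr sn1) => [eL1Y | [M [sn1M nsMY prMY]]].
  rewrite -eL1Y in sn2; case: (subnormalEr sn2) => [|[M [sn2M nsM prM]]]; first by left.
  case/simpleP: simL1 => _ /(_ M nsM)[] eM; last by rewrite eM properxx in prM.
  by case/simpleP: simL2 => /negP[]; rewrite -subG1 -eM subnormal_sub.
have ltM : #|M| < n by apply: leq_trans (proper_card prMY) _; rewrite -ltnS.
case: (subnormal_simple_sub_or_cent sn2 simL2 nab2 nsMY) => [sL2M | cML2].
  apply: (IHn M) => //; have := setI_subnormal (normal_sub nsMY) sn2.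
  by rewrite (setIidPl sL2M).
by right; apply: subset_trans (subnormal_sub sn1M) cML2.
Qed.

Lemma subnormalJ Y L x : L <|<| Y -> L :^ x <|<| Y :^ x.
Proof.
move=> snLY; have := morphim_subnormal [morphism of conjgm Y x] snLY.
by rewrite !morphim_conj setIid (setIidPr (subnormal_sub snLY)).
Qed.

Lemma simpleJ L x : simple (L :^ x) = simple L.
Proof. by rewrite (isog_simple (conj_isog L x)). Qed.

(** Each new factor normalises the group generated by the others, so the join is a product. *)
Lemma pgroup_gen_bigcup_norm (pi : nat_pred) (I : Type) (r : seq I) (P : pred I)
    (F : I -> {group gT}) :
    (forall i, P i -> pi.-group (F i)) ->
    (forall i j, P i -> P j -> F i \subset 'N(F j)) ->
  pi.-group <<\bigcup_(i <- r | P i) F i>>.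
Proof.
move=> piF nF; elim: r => [|i r IHr]; first by rewrite big_nil gen0 pgroup1.
rewrite big_cons; case: ifP => // Pi.
rewrite -joingE -joingC -joing_idl norm_joinEr; first by rewrite pgroupM piF // andbT.
apply: subset_trans (norm_gen _); elim/big_ind: _ => [|B C nB nC|j Pj].
- by apply/subsetP => x _; rewrite inE sub_conjg sub0set.
- exact: normsU.
- exact: nF.
Qed.

Section PiMaximal.
Variables (pi : nat_pred) (Y L K : {group gT}).
Hypotheses (snLY : L <|<| Y) (simL : simple L) (nabL : ~~ abelian L).
Hypothesis maxK : [max K | pi.-subgroup(Y) K].

(* The conjugates of [L] commute pairwise, so the [K]-conjugates of [A]       *)
(* generate a pi-group normalised by [K].                                     *)
Lemma sub_pi_maximal_of_norm A :
  pi.-group A -> A \subset L -> 'N_K(L) \subset 'N(A) -> A \subset K.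
Proof.
move=> piA sAL nAN.
have [/andP[sKY piK] maxKP] := maxgroupP maxK.
pose B := <<\bigcup_(k in K) (A :^ k)>>%G.
have piB : pi.-group B.
  apply: (@pgroup_gen_bigcup_norm _ _ _ _ (fun k => A :^ k)%G) => [k _|k l Kk Kl]; first by rewrite pgroupJ.
  have snJ m : m \in K -> L :^ m <|<| Y.
    by move=> Km; rewrite -[Y : {set gT}](conjGid (subsetP sKY m Km)) subnormalJ.
  have nabJ m : ~~ abelian (L :^ m) by rewrite abelianJ.
  have [||||||/= eL|/= cL] := @subnormal_simple_eq_or_cent Y (L :^ k) (L :^ l);
    rewrite ?simpleJ ?snJ ?nabJ //.
    (* Equal conjugates of [L] come with equal conjugates of [A], because [k * l^-1] normalises [L]
       and hence [A]. *)
    have : k * l^-1 \in 'N_K(L).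
      by rewrite inE groupM ?groupV //=; apply/normP; rewrite conjsgM eL conjsgK.
    move/(subsetP nAN)/normP; rewrite conjsgM => eA.
    by rewrite -{2}eA conjsgKV normG.
  apply: cents_norm; apply: subset_trans (_ : L :^ k \subset _); first by rewrite conjSg.
  by apply: subset_trans cL _; rewrite centS // conjSg.
have nBK : K \subset 'N(B).
  apply/subsetP => x Kx; rewrite inE -genJ gen_subG.
  rewrite sub_conjg; apply/bigcupsP => k Kk.
  rewrite -sub_conjg -conjsgM.
  apply: subset_trans (subset_gen _).
  by rewrite (bigcup_max (k * x)) // groupM.
have sBY : B \subset Y.
  rewrite gen_subG; apply/bigcupsP => k Kk.
  rewrite -(conjGid (subsetP sKY k Kk)) conjSg (subset_trans sAL) //.
  exact: subnormal_sub.
have eKB : (K <*> B)%G :=: K.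
  apply: maxKP; last exact: joing_subl.
  by rewrite /psubgroup join_subG sKY sBY /= norm_joinEl // pgroupM piK.
rewrite -eKB; apply: subset_trans (joing_subr _ _).
apply: subset_trans (subset_gen _).
by rewrite (bigcup_max 1) //= conjsg1.
Qed.

(** Project ['N_K(L)] to [L] along ['C(L)]. The image [P] is a pi-group normalised by ['N_K(L)], so
    [sub_pi_maximal_of_norm] puts it in [K], hence in [A]. Every element of ['N_K(L)] is then an
    element of [A] times one centralising [A], and the same lemma applies to [A]. *)
Lemma sub_pi_maximal_of_inner A :
    'N_K(L) \subset L * 'C(L) -> pi.-group A -> K :&: L \subset A -> A \subset L ->
  A \subset K.
Proof.
move=> innerK piA sHA sAL; have [/andP[sKY piK] _] := maxgroupP maxK.
have nCN : 'N_K(L) \subset 'N('C(L)).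
  by apply: subset_trans (subsetIr _ _) _; apply: cent_norm.
have TI : 'C(L) :&: L = 1.
  case/simpleP: simL => _ /(_ 'C_L(L)%G) /= H; rewrite setIC.
  have ns : 'C_L(L) <| L by have := subcent_normal L L; rewrite (setIidPl (normG L)).
  case: (H ns) => // eC; case/negP: nabL; rewrite /abelian -{1}eC; exact: subsetIr.
pose P := (('N_K(L) <*> 'C(L)) :&: L)%G.
have sPK : P \subset K.
  apply: sub_pi_maximal_of_norm; last first.
  - apply: normsI; last exact: subsetIr.
    by apply: subset_trans (normG _); apply: joing_subl.
  - exact: subsetIr.
  have nCP : P \subset 'N('C(L)).
    by apply: subset_trans (subsetIl _ _) _; rewrite join_subG nCN normG.
  have tiP : 'C(L) :&: P = 1.
    by apply/eqP; rewrite -subG1 -TI setIS // subsetIr.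
  rewrite /pgroup (card_isog (quotient_isog nCP tiP)) -/(pgroup _ _).
  apply: (pgroupS (G := ('N_K(L) / 'C(L))%G)).
    by rewrite /= -(quotientYidr nCN) quotientS ?subsetIl.
  by apply/quotient_pgroup/(pgroupS _ piK)/subsetIl.
apply: sub_pi_maximal_of_norm => //; apply/subsetP => n Nn.
have /mulsgP[l c Ll Cc en] := subsetP innerK n Nn.
have Al : l \in A.
  apply: (subsetP sHA); rewrite inE Ll andbT; apply: (subsetP sPK).
  rewrite inE Ll andbT (_ : l = n * c^-1); last by rewrite en mulgK.
  by rewrite groupM ?groupV // mem_gen // inE ?Nn // Cc orbT.
rewrite en; apply: groupM; first exact: subsetP (normG A) l Al.
by apply: subsetP (cent_sub A) c (subsetP (centS sAL) c Cc).
Qed.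
End PiMaximal.
End Components.

(** * Subnormal subgroups, action on a group of order 8, quotients by pi-subgroups *)

Lemma card_GL3_2 : #|'GL_3['F_2]| = 168.
Proof. by rewrite card_GL // card_Fp // (_ : index_iota 1 4 = [:: 1%N; 2; 3]) // !big_cons big_nil. Qed.

Section General.
Variable gT : finGroupType.
Implicit Types A B W N R K G : {group gT}.

Lemma subnormal_pcore (pi : nat_pred) A B : A <|<| B -> 'O_pi(A) \subset 'O_pi(B).
Proof.
case/subnormalP=> s; elim: s A => [|M s IHs] A /=; first by move=> _ <-.
case/andP=> nsAM sM eB; apply: subset_trans (IHs _ sM eB).
by rewrite pcore_max ?pcore_pgroup ?(gFnormal_trans _ nsAM).
Qed.

(** Every factor of a subnormal chain is a p-group, where the image of a p'-element is trivial. *)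
Lemma subnormal_p'elt (p : nat) A B x :
  A <|<| B -> p.-nat #|B : A| -> x \in B -> p^'.-elt x -> x \in A.
Proof.
case/subnormalP=> s; elim: s A => [|M s IHs] A /=; first by move=> _ <-.
case/andP=> nsAM sM eB pBA Bx p'x.
have sMB : M \subset B by apply: subnormal_sub; apply/subnormalP; exists s.
move: pBA; rewrite -(Lagrange_index sMB (normal_sub nsAM)) pnatM => /andP[pBM pMA].
have Mx := IHs M sM eB pBM Bx p'x.
have Nx : x \in 'N(A) := subsetP (normal_norm nsAM) x Mx.
rewrite coset_idr //; apply/eqP; rewrite -order_eq1; apply/eqP.
have p1 : p.-nat #[coset A x].
  apply: pnat_dvd pMA; rewrite -card_quotient ?normal_norm //.
  by rewrite order_dvdG // mem_quotient.
by apply: (pnat_1 p1); apply: morph_p_elt.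
Qed.

Lemma index_cent_abelem8 W N :
  2.-abelem W -> #|W| = 8 -> N \subset 'N(W) -> #|N : 'C_N(W)| <= 168.
Proof.
move=> abelW oW nWN; have ntW : W :!=: 1 by rewrite -cardG_gt1 oW.
have := max_card (mem (reprGLm (abelem_repr abelW ntW nWN) @* N)).
rewrite card_morphim ker_reprGLm rker_abelem setIid => /leq_trans; apply.
rewrite -cardsT -/(GLgroup _ _) -card_GL3_2 (dim_abelemE abelW ntW) oW.
by rewrite (_ : logn 2 8 = 3).
Qed.

Lemma quotient_maxgroup (pi : nat_pred) G K R :
    R <| G -> pi.-group R -> [max K | pi.-subgroup(G) K] ->
  maxgroup (K / R) (fun H : {group coset_of R} => pi.-subgroup(G / R) H).
Proof.
move=> nsRG piR maxK; have [/andP[sKG piK] maxKP] := maxgroupP maxK.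
have sRK : R \subset K := normal_sub_max_pgroup maxK piR nsRG.
apply/maxgroupP; split=> [|H /andP[sHG piH] sKH].
  by rewrite /psubgroup quotientS // quotient_pgroup.
have [H1 eH sRH sH1G] := inv_quotientS nsRG sHG.
have nRH : R <| H1 := normalS sRH sH1G nsRG.
rewrite eH (maxKP H1) //.
  by rewrite /psubgroup sH1G -(pquotient_pgroup piR) ?normal_norm // -eH.
by rewrite -(quotientSGK _ sRH) -?eH // (subset_trans sKG) // normal_norm.
Qed.
End General.

(** * Extensions of an elementary abelian group of order 8 by its automorphism group *)

Section AffineType.
Variables (gT : finGroupType) (X W : {group gT}).
(** An intrinsic description of [V : GL_3(2)], chosen because it transports along injective
    morphisms into an arbitrary overgroup. *)
Hypotheses (nsWX : W <| X) (abelW : 2.-abelem W) (oW : #|W| = 8).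
Hypotheses (cWX : 'C_X(W) = W) (iXW : #|X : W| = 168).
Hypothesis trX : {in W^#, forall v, v ^: X = W^#}.

Lemma index_affine_cent1 v : v \in W^# -> #|X : 'C_X[v]| = 7.
Proof.
by move=> Wv; rewrite index_cent1 trX //; move: oW; rewrite (cardsD1 1 W) group1 => -[].
Qed.

Lemma affine_sub_cent1 v : v \in W -> W \subset 'C_X[v].
Proof.
move=> Wv; rewrite subsetI normal_sub // sub_cent1.
exact: subsetP (abelem_abelian abelW) v Wv.
Qed.

(** [A] is the image of ['C_X[v]]. The preimage [E] of its core is normal in [X] and fixes [v],
    hence fixes all conjugates of [v], that is all of [W]; so [E] lies in ['C_X(W) = W]. *)
Lemma affine_stabilizer : exists2 A : {group coset_of W},
  (A \subset X / W) && (#|X / W : A| == 7) & gcore A (X / W) = 1.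
Proof.
have [v Wv] : exists v, v \in W^#.
  by apply/set0Pn; rewrite -card_gt0; move: oW; rewrite (cardsD1 1 W) group1 add1n => -[->].
have [nt_v Wv'] := setD1P Wv.
exists ('C_X[v] / W)%G.
  rewrite quotientS ?subsetIl //= index_quotient_eq ?index_affine_cent1 //.
  - by rewrite subIset // (affine_sub_cent1 Wv') orbT.
  - exact: subsetIl.
  - exact: normal_norm.
have nsC : gcore ('C_X[v] / W) (X / W) <| X / W.
  by apply: gcore_normal; apply: quotientS; apply: subsetIl.
have [E eE sWE nsEX] := inv_quotientN nsWX nsC.
rewrite eE; apply: quotientS1; rewrite -cWX subsetI normal_sub //.
have nWE : E \subset 'N(W) := subset_trans (normal_sub nsEX) (normal_norm nsWX).
have sEv : E \subset 'C[v].
  have : E / W \subset 'C_X[v] / W by rewrite -eE gcore_sub.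
  by rewrite quotientSGK ?affine_sub_cent1 // subsetI => /andP[].
rewrite centsC; apply/subsetP => u Wu.
have [-> | ntu] := eqVneq u 1; first exact: group1.
have : u \in v ^: X by rewrite trX // !inE ntu.
case/imsetP=> x Xx ->; rewrite -sub_cent1 -cent_set1 -conjg_set1 centJ cent_set1.
by rewrite -(normsP (normal_norm nsEX) x Xx) conjSg.
Qed.

Lemma affine_simple : simple (X / W).
Proof.
have [A /andP[sA /eqP iA] core] := affine_stabilizer.
by apply: simple168 sA iA core; rewrite card_quotient ?normal_norm.
Qed.

Lemma affine_nonabelian : ~~ abelian (X / W).
Proof.
have [A /andP[sA /eqP iA] core] := affine_stabilizer.
by apply: simple168_nonabelian sA iA core; rewrite card_quotient ?normal_norm.
Qed.

Lemma affine_card : #|X| = 1344.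
Proof. by rewrite -(Lagrange (normal_sub nsWX)) oW iXW. Qed.

(** The generated subgroup [E] is normal and covers the simple group [X / W], since it contains an
    element of order 7. If [E] met [W] trivially, it would centralise [W] and so be trivial;
    otherwise transitivity on [W^#] gives [W \subset E]. *)
Lemma affine_gen_2'elts : <<[set x in X | (2 : nat_pred)^'.-elt x]>> = X.
Proof.
set S := [set x in X | _]; pose E := <<S>>%G.
have sEX : E \subset X by rewrite gen_subG; apply/subsetP => x; rewrite inE => /andP[].
have nsEX : E <| X.
  rewrite /normal sEX; apply: subset_trans (norm_gen _); apply/subsetP => y Xy.
  rewrite inE; apply/subsetP => _ /imsetP[x + ->]; rewrite !inE => /andP[Xx p'x].
  by rewrite groupJ //= p_eltJ.
have EW : E / W = X / W.
  case/simpleP: affine_simple => _ /(_ _ (quotient_normal W nsEX))[] //= EW1.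
  have [x Xx ox] : {x | x \in X & #[x] = 7} by apply: Cauchy; rewrite // affine_card.
  have: x \in W.
    apply: (subsetP (_ : E \subset W)).
      by rewrite -quotient_sub1 ?EW1 // (subset_trans sEX) ?normal_norm.
    by apply: mem_gen; rewrite inE Xx /p_elt ox.
  by move/order_dvdG; rewrite ox oW.
have sWE : W \subset E.
  have [tiEW | [v]] := set_0Vmem ((E :&: W)^#).
    case/negP: affine_nonabelian; rewrite -EW.
    suff -> : E :=: 1 by rewrite quotient1 abelian1.
    apply/eqP; rewrite -subG1; move/eqP: tiEW; rewrite setD_eq0 => tiEW.
    apply: subset_trans (tiEW); rewrite subsetI subxx -cWX subsetI sEX.
    apply/commG1P/eqP; rewrite -subG1; apply: subset_trans tiEW.
    apply: commg_subI; rewrite subsetI subxx /=.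
      exact: subset_trans sEX (normal_norm nsWX).
    exact: subset_trans (normal_sub nsWX) (normal_norm nsEX).
  case/setD1P=> ntv /setIP[Ev Wv]; apply/subsetP => u Wu.
  have [-> | ntu] := eqVneq u 1; first exact: group1.
  have : u \in v ^: X by rewrite trX // !inE ?ntu ?ntv.
  case/imsetP=> x Xx ->; rewrite memJ_norm //; exact: subsetP (normal_norm nsEX) x Xx.
apply/eqP; rewrite eqEsubset [_ \subset X]sEX /=.
by rewrite -(quotientSGK (normal_norm nsWX) sWE) [E / W]EW.
Qed.
End AffineType.

Section AffineNotSubmaximal.
Variables (gT : finGroupType) (X W Y K : {group gT}).
Hypotheses (nsWX : W <| X) (abelW : 2.-abelem W) (oW : #|W| = 8).
Hypotheses (cWX : 'C_X(W) = W) (iXW : #|X : W| = 168).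
Hypothesis trX : {in W^#, forall v, v ^: X = W^#}.
Hypothesis snXY : X <|<| Y.
Let R := 'O_2(Y)%G.

Let simXW : simple (X / W). Proof. exact: affine_simple. Qed.
Let nabXW : ~~ abelian (X / W). Proof. exact: affine_nonabelian. Qed.
Let oX : #|X| = 1344. Proof. exact: (affine_card nsWX oW iXW). Qed.
Let sXY : X \subset Y. Proof. exact: subnormal_sub. Qed.
Let nsRY : R <| Y. Proof. exact: pcore_normal. Qed.
Let nRX : X \subset 'N(R). Proof. exact: subset_trans sXY (normal_norm nsRY). Qed.

Lemma affine_setI_pcore : X :&: R = W.
Proof.
have sWR : W \subset R.
  apply: subset_trans (subnormal_pcore 2 snXY).
  by rewrite pcore_max // abelem_pgroup.
have sWXR : W \subset X :&: R by rewrite subsetI normal_sub.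
have nsXR : X :&: R <| X by rewrite /normal subsetIl normsI ?normG.
have p2 : 2.-group (X :&: R) := pgroupS (subsetIr X R) (pcore_pgroup 2 Y).
case/simpleP: simXW => _ /(_ _ (quotient_normal W nsXR))[] /= e.
  apply/eqP; rewrite eqEsubset sWXR andbT -quotient_sub1 ?e //.
  exact: subset_trans (normal_sub nsXR) (normal_norm nsWX).
have := quotient_pgroup W p2; rewrite e /pgroup card_quotient ?normal_norm // iXW.
by [].
Qed.

Let XR := (X <*> R)%G.

Let quo_isog : X / W \isog X / R.
Proof.
have := second_isog nRX; by rewrite setIC affine_setI_pcore.
Qed.

(** [X] is subnormal of 2-power index in [XR], so it contains every element of odd order of [XR]. As
    [X] is generated by such elements, whatever normalises [XR] normalises [X]. *)
Lemma affine_norm_overgroup : 'N_Y(XR) \subset 'N(X).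
Proof.
have snXXR : X <|<| XR.
  have := setI_subnormal (_ : XR \subset Y) snXY.
  rewrite (setIidPl (joing_subl _ _)); apply.
  by rewrite join_subG sXY normal_sub.
have p2 : (2 : nat_pred).-nat #|XR : X|.
  apply: (pnat_dvd _ (pcore_pgroup 2 Y)); apply/dvdnP; exists #|W|.
  apply/eqP; rewrite -(eqn_pmul2l (cardG_gt0 X)) mulnCA Lagrange ?joing_subl //.
  by rewrite (mul_cardG X R) -norm_joinEl //= affine_setI_pcore mulnC.
apply/subsetP => n /setIP[_ nXR]; rewrite inE.
rewrite -{1}(affine_gen_2'elts nsWX abelW oW cWX iXW trX) -genJ gen_subG.
apply/subsetP => _ /imsetP[x + ->]; rewrite inE => /andP[Xx p'x].
apply: subnormal_p'elt snXXR p2 _ _; last by rewrite p_eltJ.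
by rewrite memJ_norm // (subsetP (joing_subl X R)).
Qed.

(** [X] already induces 168 automorphisms on [W], the maximum allowed by [index_cent_abelem8]. *)
Lemma affine_norm_inner : 'N_Y(XR) \subset X * 'C(W).
Proof.
set N := 'N_Y(XR).
have nNX : N \subset 'N(X) := affine_norm_overgroup.
have nNW : N \subset 'N(W).
  rewrite -affine_setI_pcore normsI // (subset_trans (subsetIl _ _)) //.
  exact: normal_norm.
have sXN : X \subset N.
  by rewrite subsetI sXY (subset_trans (joing_subl X R)) // normG.
have nXC : X \subset 'N('C_N(W)).
  apply: subset_trans sXN _; have := subcent_normal N W.
  by rewrite (setIidPl nNW) => /normal_norm.
have iN := index_cent_abelem8 abelW oW nNW.
have sXCN : X * 'C_N(W) \subset N by rewrite mul_subG // subsetIl.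
have eXC : X * 'C_N(W) = N.
  apply/eqP; rewrite eqEcard sXCN /=.
  have := mul_cardG X 'C_N(W); rewrite setIA (setIidPl sXN) cWX => e.
  rewrite -(leq_pmul2r (cardG_gt0 W)) -e -(Lagrange (normal_sub nsWX)) iXW.
  rewrite -(Lagrange (subsetIl N 'C(W))) mulnC -mulnA leq_pmul2l // mulnC.
  by rewrite leq_pmul2r.
by rewrite -eXC mulgS ?subsetIr.
Qed.

(** [X] and the centraliser of [W] in ['N_Y(XR)] normalise each other, so their commutator lies in
    ['C_X(W) = W], which vanishes modulo [R]. *)
Lemma affine_norm_quotient_inner : 'N_(Y / R)(X / R) \subset X / R * 'C(X / R).
Proof.
have nRY' := normal_norm nsRY.
have sXRY : XR \subset Y by rewrite join_subG sXY normal_sub.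
have sNY : 'N_Y(XR) \subset Y by apply: subsetIl.
have sXN : X \subset 'N_Y(XR) by rewrite subsetI sXY (subset_trans (joing_subl X R)) // normG.
apply/subsetP => _ /setIP[/morphimP[n Nn Yn ->] nXRn].
have Nn' : n \in 'N_Y(XR).
  rewrite inE Yn inE -(quotientSGK _ (joing_subr X R)); last first.
    by rewrite sub_conjg (subset_trans sXRY) // -sub_conjg (subset_trans _ nRY') // conj_subG.
  rewrite quotientJ // quotientYidr //.
  by move: nXRn; rewrite inE.
have /mulsgP[x c Xx Cc en] := subsetP affine_norm_inner n Nn'.
have Nc : c \in 'C_('N_Y(XR))(W).
  rewrite inE Cc andbT (_ : c = x^-1 * n); last by rewrite en mulKg.
  by rewrite groupM ?groupV // (subsetP sXN).
have nRc : c \in 'N(R).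
  by case/setIP: Nc => Nc _; apply: subsetP nRY' c (subsetP sNY c Nc).
rewrite en morphM ?(subsetP nRX x Xx) //=; apply: mem_mulg; first exact: mem_quotient.
have: coset R c \in 'C_('N_Y(XR))(W) / R by apply: mem_quotient.
apply: subsetP; apply: quotient_cents2r.
apply: subset_trans (_ : 'C_X(W) \subset R); last by rewrite cWX -affine_setI_pcore subsetIr.
rewrite subsetI; apply/andP; split.
  by rewrite commg_subr (subset_trans (subsetIl _ _)) ?affine_norm_overgroup.
apply: subset_trans (_ : 'C_('N_Y(XR))(W) \subset 'C(W)); last exact: subsetIr.
rewrite commg_subl; apply: subset_trans sXN _.
have nNW : 'N_Y(XR) \subset 'N(W).
  rewrite -affine_setI_pcore normsI ?affine_norm_overgroup //.
  exact: subset_trans sNY nRY'.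
by have := subcent_normal 'N_Y(XR) W; rewrite (setIidPl nNW) => /normal_norm.
Qed.

(** The 2-group [X :&: K] centralises some [v != 1] in [W], so it lies in ['C_X[v]], a pi-group of
    order 1344 / 7 = 192. Arguing modulo [R], pi-maximality forces this centraliser into [K],
    although [X :&: K] has order 64. *)
Theorem affine_Sylow2_not_pi_submaximal :
  [max K | pi23.-subgroup(Y) K] -> 2.-Sylow(X) (X :&: K) -> False.
Proof.
move=> maxK sylT; have [/andP[sKY piK] _] := maxgroupP maxK.
have sub23 : {subset (2 : nat_pred) <= pi23} by move=> p; rewrite !inE => ->.
have piR : pi23.-group R := sub_pgroup sub23 (pcore_pgroup 2 Y).
have sRK : R \subset K := normal_sub_max_pgroup maxK piR nsRY.
have sWT : W \subset X :&: K.
  by rewrite -affine_setI_pcore setIS.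
have ntW : W :!=: 1 by rewrite -cardG_gt1 oW.
have nsWT : W <| X :&: K := normalS sWT (subsetIl X K) nsWX.
have [v /setIP[Wv /setIP[_ cTv]] ntv] : exists2 v, v \in W :&: 'Z(X :&: K) & v != 1.
  have := meet_center_nil (pgroup_nil (pHall_pgroup sylT)) nsWT ntW.
  by case/trivgPn => v; exists v.
have Wv' : v \in W^# by rewrite !inE ntv.
have sTA : X :&: K \subset 'C_X[v] by rewrite subsetI subsetIl sub_cent1.
have oA : #|'C_X[v]| = 192.
  have := Lagrange (subsetIl X 'C[v]); rewrite (index_affine_cent1 oW trX Wv') oX.
  by move=> e; apply/eqP; rewrite -(eqn_pmul2r (isT : 0 < 7)) e.
have oT : #|X :&: K| = 64.
  by rewrite (card_Hall sylT) oX p_part.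
have simL : simple (X / R) by rewrite -(isog_simple quo_isog).
have nabL : ~~ abelian (X / R) by rewrite -(isog_abelian quo_isog).
have sA : 'C_X[v] / R \subset K / R.
  apply: (@sub_pi_maximal_of_inner _ pi23 (Y / R) (X / R) (K / R)) => //.
  - exact: quotient_subnormal.
  - exact: quotient_maxgroup.
  - apply: subset_trans affine_norm_quotient_inner.
    by apply: setSI; apply: quotientS.
  - by rewrite quotient_pgroup // /pgroup oA.
  - by rewrite setIC -quotientIG // quotientS.
  - by apply: quotientS; apply: subsetIl.
have sAK : 'C_X[v] \subset K.
  by rewrite -(quotientSGK _ sRK) // (subset_trans (subsetIl X _)).
have := subset_leq_card (_ : 'C_X[v] \subset X :&: K); rewrite oA oT.
by rewrite subsetI subsetIl sAK => /(_ isT).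
Qed.
End AffineNotSubmaximal.

(** * pi-maximality of Sylow 2-subgroups in a degree two extension *)

Section DegreeTwoExtension.
Variables (gT : finGroupType) (Y F U S : {group gT}) (x : gT).
Hypotheses (nsFY : F <| Y) (iYF : #|Y : F| = 2).
Hypotheses (nsUY : U <| Y) (p2U : 2.-group U) (sUF : U \subset F).
Hypotheses (simFU : simple (F / U)) (iFU : #|F : U| = 168).
Hypotheses (Yx : x \in Y) (Fx4 : x ^+ 4 \in F) (Ux4 : x ^+ 4 \notin U) (Ux8 : x ^+ 8 \in U).

(** Counting [C * H :^ g] inside [Y] bounds the index of [I] in [C] by 7; it divides 8 because
    [x ^+ 8] is in [U]. Hence it divides 4. *)
Lemma gcore_expg4 (H : {group gT}) :
  U \subset H -> H \subset Y -> #|Y : H| = 7 -> x ^+ 4 \in gcore H Y.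
Proof.
move=> sUH sHY iYH; apply/bigcapP => g Yg.
pose C := <[x]>%G; pose I := (C :&: H :^ g)%G.
have sUHg : U \subset H :^ g.
  by rewrite -(normsP (normal_norm nsUY) g Yg) conjSg.
have I8 : x ^+ 8 \in I by rewrite inE mem_cycle (subsetP sUHg).
have nIx : x \in 'N(I).
  by apply: (subsetP (_ : C \subset _)); rewrite ?cycle_id // sub_abelian_norm ?cycle_abelian ?subsetIl.
suff: coset I x ^+ 4 = 1.
  rewrite -morphX // => /coset_idr; rewrite groupX // => /(_ isT).
  by case/setIP.
have o8 : #[coset I x] %| 8 by rewrite order_dvdn -morphX //= coset_id.
have o7 : #[coset I x] <= 7.
  have -> : #[coset I x] = #|C : I|.
    by rewrite /order -quotient_cycle // card_quotient // cycle_subG.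
  have sCH : C * H :^ g \subset Y.
    by rewrite mul_subG ?cycle_subG // -(conjGid Yg) conjSg.
  have := subset_leq_card sCH; rewrite -(leq_pmul2r (cardG_gt0 I)) -mul_cardG cardJg.
  rewrite -(Lagrange sHY) iYH -(Lagrange (subsetIl C (H :^ g))) -/(gval I).
  by rewrite -mulnA [leqRHS]mulnC leq_pmul2l // mulnC leq_pmul2l.
have: #[coset I x] \in divisors 8 by rewrite -dvdn_divisors.
move=> o; apply/eqP; rewrite -order_dvdn.
by move: o o7; rewrite (_ : divisors 8 = [:: 1%N; 2; 4; 8]) // !inE => /or4P[] /eqP->.
Qed.

Lemma pi_maximal_of_Sylow2 (K : {group gT}) :
  2.-Sylow(Y) K -> [max K | pi23.-subgroup(Y) K].
Proof.
move=> sylK; have [sKY pK _] := and3P sylK.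
have sub23 : {subset (2 : nat_pred) <= pi23} by move=> p; rewrite !inE => ->.
have sUK : U \subset K.
  by apply: subset_trans (pcore_sub_Hall sylK); rewrite pcore_max.
apply/maxgroupP; split=> [|H /andP[sHY piH] sKH]; first by rewrite /psubgroup sKY (sub_pgroup sub23).
have sUY := normal_sub nsUY; have sUH := subset_trans sUK sKH.
have n7H : ~~ (7 %| #|H|).
  by apply/negP => d7; have := pgroupP piH 7 isT d7.
have oY : #|Y| = (#|U| * 168 * 2)%N.
  by rewrite -(Lagrange (normal_sub nsFY)) iYF -(Lagrange sUF) iFU.
have oK : #|K| = (#|U| * 16)%N.
  rewrite (card_Hall sylK) oY -mulnA partnM // part_pnat_id //; congr (_ * _)%N.
  by rewrite p_part.
have iYK : #|Y : K| = 21.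
  by rewrite -divgS // oY oK -mulnA divnMl.
have iKH : (#|Y : H| * #|H : K|)%N = 21 by rewrite Lagrange_index.
have dHK : #|H : K| \in divisors 21 by rewrite -dvdn_divisors // -iKH dvdn_mull.
have n7HK : ~~ (7 %| #|H : K|) by apply: contra n7H => /dvdn_trans->; rewrite ?dvdn_indexg.
move: dHK n7HK iKH; rewrite (_ : divisors 21 = [:: 1%N; 3; 7; 21]) // !inE.
case/or4P=> /eqP e //; rewrite e //.
  (* Index 1 gives [H = K]; the surviving alternative is index 3, where [H] has index 7 in [Y]. *)
  by move=> _ _; apply/eqP; rewrite eqEsubset sKH -indexg_eq1 e.
move=> _ /eqP; rewrite -[21]/(7 * 3)%N eqn_pmul2r // => /eqP iYH.
have x4 := gcore_expg4 sUH sHY iYH.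
pose D := (gcore H Y :&: F)%G.
have nsDF : D <| F.
  rewrite /normal subsetIr normsI ?normG //.
  exact: subset_trans (normal_sub nsFY) (gcore_norm H Y).
case/negP: n7H; case/simpleP: simFU => _ /(_ _ (quotient_normal U nsDF))[] /= eD.
  case/negP: Ux4; have nUx : x ^+ 4 \in 'N(U) by rewrite groupX // (subsetP (normal_norm nsUY)).
  apply: coset_idr nUx _; apply/eqP; rewrite -in_set1 -[[set 1]]/(1 : {set _}) -eD.
  by rewrite mem_quotient // inE x4.
have dD : #|D / U| %| #|H|.
  apply: dvdn_trans (dvdn_quotient _ _) _; apply: cardSg.
  by apply: subset_trans (subsetIl _ _) (gcore_sub _ _).
apply: dvdn_trans dD; rewrite eD card_quotient ?iFU //.
exact: subset_trans (normal_sub nsFY) (normal_norm nsUY).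
Qed.

Lemma Sylow2_setI_pi_maximal : 2.-Sylow(F) S ->
  exists2 K : {group gT}, pi_maximal pi23 Y K & S :=: F :&: K.
Proof.
move=> sylS; have sSY := subset_trans (pHall_sub sylS) (normal_sub nsFY).
have [K sylK sSK] := Sylow_superset sSY (pHall_pgroup sylS).
exists K; first exact: pi_maximal_of_Sylow2.
apply/eqP; rewrite eqEcard subsetI sSK (pHall_sub sylS) /=.
by rewrite (card_Hall sylS) (card_Hall (Sylow_setI_normal nsFY sylK)).
Qed.
End DegreeTwoExtension.

(** * The group (V (+) V^* ) : GL_3(2) *)

Section Concrete.
Local Open Scope ring_scope.
Local Notation to := ('MR double_repr)%gact.
Local Notation rV3 := 'rV['F_2]_3.
Local Notation rV6 := 'rV['F_2]_(3 + 3).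
Local Notation GL3 := {'GL_3['F_2]}.
Local Notation dualGL := (reprGLm (contragredient_repr natural_repr)).

Definition transl (u : rV6) : semidirectT := sdpair1 to u.
Definition levi (a : GL3) : semidirectT := sdpair2 to a.

Lemma translM u v : transl (u + v) = (transl u * transl v)%g.
Proof. by rewrite /transl -sdpair1_morphM ?in_setT. Qed.

Lemma leviM a b : levi (a * b)%g = (levi a * levi b)%g.
Proof. by rewrite /levi sdpair2_morphM ?in_setT. Qed.

Lemma levi1 : levi 1%g = 1%g.
Proof. by apply: (mulgI (levi 1%g)); rewrite -leviM !mulg1. Qed.

Lemma transl_inj : injective transl.
Proof. by move=> u v; apply: (injmP (injm_sdpair1 to)); rewrite inE. Qed.

Lemma levi_inj : injective levi.
Proof. by move=> u v; apply: (injmP (injm_sdpair2 to)); rewrite inE. Qed.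

Lemma translJ u a : (transl u ^ levi a)%g = transl (u *m double_repr a).
Proof.
have := sdpair_act to (in_setT u : u \in [set: rV6]) (in_setT a : a \in 'GL_3(2)).
by rewrite /= (mx_repr_actE double_repr u (in_setT a : a \in 'GL_3(2))) => /esym.
Qed.

Lemma semidirect_decomp x : exists a u, x = (levi a * transl u)%g.
Proof. by exists x.1, x.2; apply: sdpairE. Qed.

Lemma GLval_dualGL (a : GL3) : GLval (dualGL a) = (GLval a^-1%g)^T.
Proof. by rewrite -[GLval _]/(\val _) val_reprGLm ?inE. Qed.

Lemma double_repr_row (v w : rV3) (a : GL3) :
  row_mx v w *m double_repr a = row_mx (v *m GLval a) (w *m GLval (dualGL a)).
Proof.
by rewrite GLval_dualGL [double_repr a]/= mul_row_block !mulmx0 addr0 add0r.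
Qed.

Lemma dualGLM (a b : GL3) : dualGL (a * b)%g = (dualGL a * dualGL b)%g.
Proof. exact: (reprGLmM _ (in_setT a) (in_setT b)). Qed.

Lemma dualGL1 : dualGL 1%g = 1%g :> GL3.
Proof. by apply: (mulgI (dualGL 1%g)); rewrite -dualGLM !mulg1. Qed.

Lemma dualGLV (a : GL3) : dualGL a^-1%g = (dualGL a)^-1%g.
Proof. by apply: (mulgI (dualGL a)); rewrite -dualGLM !mulgV dualGL1. Qed.

Lemma dualGLK (a : GL3) : dualGL (dualGL a) = a.
Proof.
apply: val_inj; rewrite -[LHS]/(GLval _) GLval_dualGL -dualGLV.
by rewrite GLval_dualGL invgK trmxK.
Qed.

Definition swap (u : rV6) : rV6 := row_mx (rsubmx u) (lsubmx u).

Lemma swapK : involutive swap.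
Proof. by move=> u; rewrite /swap row_mxKl row_mxKr hsubmxK. Qed.

Lemma swap_act u a : swap (u *m double_repr a) = swap u *m double_repr (dualGL a).
Proof.
rewrite -[u]hsubmxK double_repr_row /swap !row_mxKl !row_mxKr.
by rewrite double_repr_row dualGLK.
Qed.

Lemma dualVP x : reflect (exists w : rV3, x = transl (row_mx 0 w)) (x \in dualV).
Proof.
apply: (iffP idP) => [/morphimP[u _ + ->] | [w ->]].
  rewrite inE => /submxP[w ->]; exists w.
  by rewrite mul_mx_row mulmx0 mulmx1.
apply: mem_morphim; rewrite ?inE //.
by apply/submxP; exists w; rewrite mul_mx_row mulmx0 mulmx1.
Qed.

Definition translG : {group semidirectT} := (sdpair1 to @* [set: rV6])%G.

Lemma translGP x : reflect (exists u, x = transl u) (x \in translG).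
Proof.
apply: (iffP idP) => [/morphimP[u _ _ ->] | [u ->]]; first by exists u.
by apply: mem_morphim; rewrite ?inE.
Qed.

Lemma translC u v : commute (transl u) (transl v).
Proof. by rewrite /commute -!translM addrC. Qed.

Lemma transl0 : transl 0 = 1%g.
Proof. by apply: (mulgI (transl 0)); rewrite -translM addr0 mulg1. Qed.

Lemma conj_transl u a v : (transl u ^ (levi a * transl v))%g = transl (u *m double_repr a).
Proof. by rewrite conjgM translJ /conjg translC mulKg. Qed.

Lemma translG_abelem : 2.-abelem translG.
Proof. exact/morphim_abelem/mx_Fp_abelem. Qed.

Lemma dualV_sub : dualV \subset translG.
Proof. by apply: morphimS; apply/subsetP => u _; rewrite inE. Qed.

Lemma card_translG : #|translG| = 64.
Proof. by rewrite card_injm ?injm_sdpair1 // cardsT card_mx card_Fp. Qed.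

Lemma card_dualV : #|dualV| = 8.
Proof.
rewrite card_injm ?injm_sdpair1 //; last by apply/subsetP => u _; rewrite inE.
by rewrite card_rowg rank_row_0mx mxrank1 card_Fp.
Qed.

Lemma translG_normal : translG <| semidirectG.
Proof. by case/sdprod_context: (sdprod_sdpair to). Qed.

Lemma dualV_normal : dualV <| semidirectG.
Proof.
rewrite /normal subsetT; apply/subsetP => g _; rewrite inE.
apply/subsetP => _ /imsetP[_ /dualVP[w ->] ->].
have [a [u ->]] := semidirect_decomp g.
rewrite conj_transl double_repr_row mul0mx.
by apply/dualVP; eexists.
Qed.

Lemma norm_dualV g : g \in 'N(dualV).
Proof. by apply: (subsetP (normal_norm dualV_normal)); rewrite inE. Qed.

Lemma quotient_translG_isog : [set: GL3] \isog semidirectG / translG.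
Proof.
have /sdprod_isog := sdprod_sdpair to; apply: isog_trans.
by apply: sub_isog => //; apply: injm_sdpair2.
Qed.

Lemma index_translG : #|semidirectG : translG| = 168.
Proof.
by rewrite -card_quotient ?normal_norm ?translG_normal // -(card_isog quotient_translG_isog) card_GL3_2.
Qed.

(** * The quotient by [V^*] satisfies the affine hypotheses *)

Local Notation X := (semidirectG / dualV)%g.
Local Notation W := (translG / dualV)%g.

Lemma coset_transl (v w : rV3) :
  coset dualV (transl (row_mx v w)) = coset dualV (transl (row_mx v 0)).
Proof.
have -> : row_mx v w = row_mx 0 w + row_mx v 0 :> rV6.
  by rewrite add_row_mx add0r addr0.
have Vw : transl (row_mx 0 w) \in dualV by apply/dualVP; exists w.
by rewrite translM morphM ?norm_dualV //= (coset_id Vw) mul1g.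
Qed.

Lemma coset_transl_inj (v v' : rV3) :
  coset dualV (transl (row_mx v 0)) = coset dualV (transl (row_mx v' 0)) -> v = v'.
Proof.
move/eqP; rewrite eq_mulVg1 -morphV ?norm_dualV // -morphM ?groupV ?norm_dualV //.
move/eqP/coset_idr => /(_ (norm_dualV _)) /dualVP[w].
move/(canRL (mulKVg _)); rewrite -translM => /transl_inj.
by rewrite add_row_mx addr0 => /eq_row_mx[].
Qed.

Lemma quotient_translGP (x : coset_of dualV) :
  reflect (exists v : rV3, x = coset dualV (transl (row_mx v 0))) (x \in W).
Proof.
apply: (iffP idP) => [/morphimP[_ _ /translGP[u ->] ->] | [v ->]].
  by exists (lsubmx u); rewrite /= -[u in LHS]hsubmxK coset_transl.
by apply: mem_quotient; apply/translGP; eexists.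
Qed.

Lemma quotientG_decomp (x : coset_of dualV) : exists a u,
  x = coset dualV (levi a * transl u).
Proof.
have [g _ ->] := cosetP x; have [a [u ->]] := semidirect_decomp g.
by exists a, u.
Qed.

Lemma coset_translJ (v : rV3) a u :
  (coset dualV (transl (row_mx v 0)) ^ coset dualV (levi a * transl u))%g =
  coset dualV (transl (row_mx (v *m GLval a) 0)).
Proof.
by rewrite -morphJ ?norm_dualV // conj_transl double_repr_row; apply: coset_transl.
Qed.

Lemma quotient_translG_normal : W <| X.
Proof. exact: quotient_normal translG_normal. Qed.

Lemma card_quotient_translG : #|W| = 8.
Proof.
rewrite card_quotient -?divgS ?dualV_sub // ?card_translG ?card_dualV //.
by apply/subsetP => g _; apply: norm_dualV.
Qed.

(** If the coset of [levi a * transl u] centralises [W], then [a] fixes every basis row vector, so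
    [a = 1]. *)
Lemma quotient_translG_self_cent : 'C_X(W) = W.
Proof.
have abW : abelian W := abelem_abelian (quotient_abelem _ translG_abelem).
apply/eqP; rewrite eqEsubset subsetI (normal_sub quotient_translG_normal) [X in _ && X]abW andbT.
apply/subsetP => x /setIP[_ /centP cx].
have [a [u ex]] := quotientG_decomp x; rewrite ex.
suff -> : a = 1%g.
  by rewrite levi1 mul1g; apply: mem_quotient; apply/translGP; eexists.
apply: val_inj; apply/row_matrixP => i; rewrite !rowE /= -[RHS]/(delta_mx 0 i *m 1%:M) mulmx1.
apply: coset_transl_inj; rewrite -(coset_translJ _ _ u) -ex.
by rewrite /conjg -cx ?mulKg //; apply/quotient_translGP; eexists.
Qed.

Lemma index_quotient_translG : #|X : W| = 168.
Proof.
rewrite index_quotient_eq ?index_translG ?subsetT //.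
  by rewrite subIset // dualV_sub orbT.
by apply/subsetP => g _; apply: norm_dualV.
Qed.

Lemma GL_row_trans (v w : rV3) : v != 0 -> w != 0 -> exists a : GL3, v *m GLval a = w.
Proof.
(* [pinvmx v] is a right inverse of the nonzero row [v], so [f] sends [v] to [w]; it is then
   replaced by an invertible matrix agreeing with it on [v]. *)
move=> nzv nzw; pose f := pinvmx v *m w.
have fv : row_free v by rewrite /row_free rank_rV nzv.
have vf : v *m f = w by rewrite mulmxA mulmxVp // mul1mx.
have [|g ug eg] := @complete_unitmx _ _ _ v f; first by rewrite vf !rank_rV nzv nzw.
by exists (FinRing.unit _ ug); rewrite /= -eg.
Qed.

Lemma quotient_translG_trans : {in W^#, forall x, x ^: X = W^#}%g.
Proof.
move=> x /setD1P[ntx Wx]; apply/eqP; rewrite eqEsubset; apply/andP; split.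
  rewrite class_sub_norm; last by rewrite normD1 normal_norm ?quotient_translG_normal.
  by rewrite !inE ntx.
have [v ex] := quotient_translGP _ Wx.
apply/subsetP => y /setD1P[nty /quotient_translGP[w ey]].
have nz (u : rV3) : coset dualV (transl (row_mx u 0)) != 1%g -> u != 0.
  by apply: contraNneq => ->; rewrite row_mx0 transl0 morph1.
have [a va] : exists a : GL3, v *m GLval a = w.
  by apply: GL_row_trans; apply: nz; rewrite -?ex -?ey.
apply/imsetP; exists (coset dualV (levi a * transl 0)); first by rewrite mem_quotient ?inE.
by rewrite ex ey coset_translJ va.
Qed.

Lemma semidirect_decomp_inj a b u v :
  (levi a * transl u = levi b * transl v)%g -> a = b /\ u = v.
Proof.
move=> e; have e1 : levi (b^-1 * a) = transl (v - u).
  apply: (mulIg (transl u)); rewrite -translM subrK leviM -mulgA e mulgA -leviM mulVg.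
  by rewrite levi1 mul1g.
have : levi (b^-1 * a) \in (sdpair1 to @* setT :&: sdpair2 to @* setT)%g.
  by rewrite inE {1}e1 !mem_morphim ?inE.
rewrite im_sdpair_TI => /set1P e2; split.
  by apply/eqP; rewrite eq_sym eq_mulVg1; apply/eqP/levi_inj; rewrite e2 levi1.
by apply/eqP; rewrite eq_sym -subr_eq0; apply/eqP/transl_inj; rewrite -e1 e2 transl0.
Qed.

(** * The twisting automorphism and the extension of degree two *)

Definition twist (x : semidirectT) : semidirectT :=
  (levi (dualGL x.1) * transl (swap x.2))%g.

Lemma twistE a u : twist (levi a * transl u)%g = (levi (dualGL a) * transl (swap u))%g.
Proof.
rewrite /twist; have := sdpairE (levi a * transl u)%g.
by case/semidirect_decomp_inj => <- <-.
Qed.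

Lemma twist_transl u : twist (transl u) = transl (swap u).
Proof. by have := twistE 1%g u; rewrite dualGL1 levi1 !mul1g. Qed.

Lemma twist_levi a : twist (levi a) = levi (dualGL a).
Proof.
have := twistE a 0; rewrite (_ : swap 0 = 0); last by rewrite /swap !linear0 row_mx0.
by rewrite transl0 !mulg1.
Qed.

Lemma mulg_conjg_exchange (gT : finGroupType) (a u b v : gT) :
  (a * u * (b * v) = a * b * (u ^ b * v))%g.
Proof. by rewrite conjgE !mulgA mulgK. Qed.

Lemma twistM : {morph twist : x y / (x * y)%g}.
Proof.
move=> x y; have [a [u ->]] := semidirect_decomp x; have [b [v ->]] := semidirect_decomp y.
have e a1 u1 b1 v1 : (levi a1 * transl u1 * (levi b1 * transl v1))%g =
    (levi (a1 * b1) * transl (u1 *m double_repr b1 + v1))%g.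
  by rewrite translM -translJ leviM; apply: mulg_conjg_exchange.
rewrite e !twistE e -swap_act dualGLM; congr (_ * transl _)%g.
by rewrite /swap !linearD -add_row_mx.
Qed.

Lemma twistK : involutive twist.
Proof.
move=> x; have [a [u ->]] := semidirect_decomp x.
by rewrite !twistE dualGLK swapK.
Qed.

Local Notation semidirectP := {perm semidirectT}.
Definition twist_perm : semidirectP := perm (can_inj twistK).
Definition regular : {morphism semidirectG >-> semidirectP} :=
  [morphism of actperm 'R%act].

Lemma regularE g x : regular g x = (x * g)%g.
Proof. exact: actpermE. Qed.

Lemma regular_inj : 'injm regular.
Proof.
apply/injmP => g h _ _ e; have := regularE g 1%g.
by rewrite e regularE !mul1g.
Qed.

Lemma regularJ g : (regular g ^ twist_perm)%g = regular (twist g).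
Proof.
rewrite conjgE; apply: (mulgI twist_perm); rewrite mulKVg; apply/permP => x.
by rewrite !permM !regularE !permE twistM.
Qed.

Lemma twist_perm2 : (twist_perm * twist_perm = 1)%g.
Proof. by apply/permP => x; rewrite permM !permE twistK. Qed.

(** The extension of [G] by [twist], realised inside the symmetric group on [G]: by [regularJ],
    conjugation by [twist_perm] acts on right translations as [twist]. *)
Definition extG : {group semidirectP} := (regular @* semidirectG <*> <[twist_perm]>)%G.

Lemma twist_norm (H : {group semidirectT}) : (forall g, g \in H -> twist g \in H) ->
  twist_perm \in 'N(regular @* H)%g.
Proof.
move=> tH; rewrite inE; apply/subsetP => _ /imsetP[_ /morphimP[g _ Hg ->] ->].
by rewrite regularJ mem_morphim ?inE ?tH.
Qed.

Lemma regular_normal (H : {group semidirectT}) : H <| semidirectG ->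
  (forall g, g \in H -> twist g \in H) -> regular @* H <| extG.
Proof.
move=> nsHG tH; apply/andP; split.
  exact: subset_trans (morphimS _ (normal_sub nsHG)) (joing_subl _ _).
rewrite [gval extG]/= join_subG cycle_subG twist_norm // andbT.
exact: morphim_norms (normal_norm nsHG).
Qed.

Lemma regularG_normal : regular @* semidirectG <| extG.
Proof. by apply: regular_normal => // g _; rewrite inE. Qed.

Lemma regular_translG_normal : regular @* translG <| extG.
Proof.
apply: regular_normal translG_normal _ => _ /translGP[u ->].
rewrite twist_transl.
by apply/translGP; eexists.
Qed.

(** [twist] fixes 1, and a right translation fixing 1 is the identity; but [twist] moves a nonzero
    vector of [V] into [V^*]. *)
Lemma twist_perm_notin : twist_perm \notin regular @* semidirectG.
Proof.
apply/negP => /morphimP[g _ _ e].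
have t1 : twist 1%g = 1%g.
  by apply: (mulgI (twist 1%g)); rewrite -twistM !mulg1.
have g1 : g = 1%g.
  by have := congr1 (fun s : semidirectP => s 1%g) e; rewrite regularE mul1g permE t1.
pose p : rV3 := const_mx 1.
have := congr1 (fun s : semidirectP => s (transl (row_mx p 0))) e.
rewrite regularE g1 mulg1 permE twist_transl => /transl_inj.
rewrite /swap row_mxKl row_mxKr => /eq_row_mx[/matrixP/(_ 0 0)].
by rewrite !mxE => /eqP.
Qed.

Lemma index_extG : #|extG : regular @* semidirectG| = 2.
Proof.
have o2 : #[twist_perm]%g = 2.
  apply: nt_prime_order => //; first exact: twist_perm2.
  by apply: contraNneq twist_perm_notin => ->; apply: group1.
have TI : regular @* semidirectG :&: <[twist_perm]>%g = 1%g.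
  rewrite setIC; apply: prime_TIg; first by rewrite -orderE o2.
  by rewrite cycle_subG twist_perm_notin.
have nF : (<[twist_perm]> \subset 'N(regular @* semidirectG))%g.
  apply: subset_trans (joing_subr _ _) (normal_norm regularG_normal).
apply/eqP; rewrite -(eqn_pmul2l (cardG_gt0 (regular @* semidirectG))).
by rewrite Lagrange ?normal_sub ?regularG_normal //= norm_joinEr // TI_cardMg // -orderE o2.
Qed.

(** * An explicit matrix giving order 8 modulo [U] *)

Definition mx3 (f : nat -> nat -> bool) : 'M['F_2]_3 := \matrix_(i, j) (f i j)%:R.

Lemma natrb_add_F2 (b c : bool) : b%:R + c%:R = (b (+) c)%:R :> 'F_2.
Proof. by case: b; case: c; apply/eqP. Qed.

Lemma natrb_mul_F2 (b c : bool) : b%:R * c%:R = (b && c)%:R :> 'F_2.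
Proof. by rewrite -natrM mulnb. Qed.

(** Over ['F_2] sums and products of entries are Boolean operations, so matrix identities reduce to
    a finite check by evaluation. *)
Lemma mx3M f g :
  mx3 f *m mx3 g =
  mx3 (fun i j => (f i 0 && g 0 j) (+) (f i 1 && g 1 j) (+) (f i 2 && g 2 j))%N.
Proof.
apply/matrixP => i j; rewrite !mxE !big_ord_recl big_ord0 !mxE.
by rewrite !natrb_mul_F2 addr0 !natrb_add_F2 addbA.
Qed.

Lemma mx3T f : (mx3 f)^T = mx3 (fun i j => f j i).
Proof. by apply/matrixP => i j; rewrite !mxE. Qed.

Lemma eq_mx3 f g : (forall i j, i < 3 -> j < 3 -> f i j = g i j)%N -> mx3 f = mx3 g.
Proof. by move=> fg; apply/matrixP => i j; rewrite !mxE fg. Qed.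

Lemma mx3_1 : mx3 (fun i j => i == j) = 1%:M.
Proof. by apply/matrixP => i j; rewrite !mxE. Qed.

(* For this matrix [a], the product [a *m a^-T] has order 4, so composing [a]  *)
(* with the inverse-transpose automorphism gives an element of order 8.       *)
Definition twist_mx (i j : nat) : bool := (i, j) \in [:: (0, 2); (1, 1); (1, 2); (2, 0)]%N.
Definition twist_mxV (i j : nat) : bool := (i, j) \in [:: (0, 2); (1, 0); (1, 1); (2, 0)]%N.
Definition twist_mxT2 (i j : nat) : bool := (i, j) \in [:: (0, 0); (1, 1); (2, 0); (2, 2)]%N.

Ltac mx3_tac := rewrite ?mx3T ?mx3M -?mx3_1; apply: eq_mx3; do 2![case=> [|[|[|?]]]] => //.

Lemma twist_mxK : mx3 twist_mx *m mx3 twist_mxV = 1%:M.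
Proof. by mx3_tac. Qed.

Lemma twist_mx_sqr : let b := mx3 twist_mx *m (mx3 twist_mxV)^T in b *m b = mx3 twist_mxT2.
Proof. by rewrite /=; mx3_tac. Qed.

Lemma twist_mxT2_sqr : mx3 twist_mxT2 *m mx3 twist_mxT2 = 1%:M.
Proof. by mx3_tac. Qed.

Lemma exists_twist_GL : exists2 a : GL3,
  ((a * dualGL a) ^+ 2 != 1)%g & ((a * dualGL a) ^+ 4 = 1)%g.
Proof.
have [uA _] := mulmx1_unit twist_mxK.
pose a : GL3 := FinRing.unit _ uA.
have vb : GLval (a * dualGL a)%g = mx3 twist_mx *m (mx3 twist_mxV)^T.
  rewrite -[LHS]/(GLval a *m GLval (dualGL a)) GLval_dualGL; congr (_ *m _^T).
  by rewrite -[LHS]/(invmx (mx3 twist_mx)) -[LHS]mulmx1 -twist_mxK mulmxA mulVmx // mul1mx.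
have vb2 : GLval ((a * dualGL a) ^+ 2)%g = mx3 twist_mxT2.
  by rewrite expgS expg1 -twist_mx_sqr -vb.
exists a.
  (* The entry at row 2, column 0 is 1 in the transvection [twist_mxT2] and 0 in the identity. *)
  apply/eqP => e; have := congr1 (fun A : 'M_3 => A 2%:R 0) vb2.
  by rewrite e !mxE => /eqP.
rewrite (expgD _ 2 2); apply: val_inj.
by rewrite -[LHS]/(GLval ((a * dualGL a) ^+ 2)%g *m GLval ((a * dualGL a) ^+ 2)%g) vb2 twist_mxT2_sqr.
Qed.

Lemma simple_quotient_translG : simple (semidirectG / translG)%g.
Proof.
have := third_isog dualV_sub dualV_normal translG_normal.
move/isog_simple <-; apply: affine_simple.
- exact: quotient_translG_normal.
- exact: quotient_abelem translG_abelem.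
- exact: card_quotient_translG.
- exact: quotient_translG_self_cent.
- exact: index_quotient_translG.
- exact: quotient_translG_trans.
Qed.

(** * Submaximality of [S] and its failure modulo [V^*] *)

Lemma Sylow2_pi_submaximal (S : {group semidirectT}) :
  2.-Sylow(semidirectG) S -> pi_submaximal pi23 semidirectG S.
Proof.
move=> sylS; split; first exact: pHall_sub sylS.
have [a b2 b4] := exists_twist_GL; set b := (a * dualGL a)%g in b2 b4.
(* The square of [x] is the image of [b = a * dualGL a], so [x ^+ 4] and [x ^+ 8] correspond to
   [b ^+ 2 != 1] and [b ^+ 4 = 1]. *)
pose x := (regular (levi a) * twist_perm)%g.
have x2 : (x ^+ 2 = regular (levi b))%g.
  rewrite expgS expg1 leviM morphM ?inE // -twist_levi -regularJ conjgE.
  rewrite (_ : twist_perm^-1 = twist_perm)%g ?mulgA //.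
  by apply: (mulgI twist_perm); rewrite mulgV twist_perm2.
have xk k : (x ^+ (2 * k) = regular (levi (b ^+ k)))%g.
  by rewrite expgM x2 /levi !morphX ?inE.
have Fx k : (x ^+ (2 * k) \in regular @* semidirectG)%g by rewrite xk mem_morphim ?inE.
have oU : #|(regular @* translG)%g| = 64 by rewrite card_injm ?regular_inj ?subsetT ?card_translG.
have nsUF : regular @* translG <| regular @* semidirectG by apply: morphim_normal translG_normal.
have simFU : simple (regular @* semidirectG / regular @* translG)%g.
  rewrite -(morphim_quotm _ translG_normal) -(isog_simple (sub_isog _ _)) //.
    exact: simple_quotient_translG.
  exact/injm_quotm/regular_inj.
have [|||||||||K maxK eS] := @Sylow2_setI_pi_maximal _ extG (regular @* semidirectG)
  (regular @* translG) (regular @* S) x regularG_normal index_extG regular_translG_normal.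
- by rewrite /pgroup oU.
- exact: normal_sub.
- exact: simFU.
- by rewrite index_injm ?regular_inj ?index_translG.
- apply: groupM; last by rewrite mem_gen // inE cycle_id orbT.
  by rewrite mem_gen // inE mem_morphim ?inE.
- exact: (Fx 2).
- rewrite (xk 2); apply: contra b2 => /morphimP[_ _ /translGP[u ->]].
  move/(injmP regular_inj); rewrite !inE => /(_ isT isT) e.
  have := @semidirect_decomp_inj (b ^+ 2) 1 0 u; rewrite transl0 levi1 mulg1 mul1g.
  by move=> /(_ e)[->].
- by rewrite (xk 4) b4 levi1 morph1 group1.
- by apply: morphim_pHall; rewrite ?subsetT.
by exists semidirectP, extG, regular, K; split=> //;
  [exact: regular_inj | apply: normal_subnormal regularG_normal].
Qed.

(** The embedding [f] carries the affine hypotheses from [X] and [W] to their images in the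
    overgroup. *)
Lemma quotient_Sylow2_not_pi_submaximal (S : {group semidirectT}) :
  2.-Sylow(semidirectG) S ->
  ~ pi_submaximal pi23 (semidirectG / dualV)%G (S / dualV)%G.
Proof.
move=> sylS [sSX [rT [Y [f [K [injf snXY maxK eS]]]]]].
have sWX := normal_sub quotient_translG_normal.
apply: (@affine_Sylow2_not_pi_submaximal rT (f @* X) (f @* W) Y K) => //.
- exact: morphim_normal quotient_translG_normal.
- exact/morphim_abelem/quotient_abelem/translG_abelem.
- by rewrite card_injm ?card_quotient_translG.
- by rewrite -injm_subcent // quotient_translG_self_cent.
- by rewrite index_injm ?index_quotient_translG.
- move=> y /setD1P[nty /morphimP[x Xx Wx ey]]; move: nty; rewrite {y}ey => nty.
  rewrite -morphim_class // quotient_translG_trans ?injmD1 // !inE Wx andbT.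
  by apply: contraNneq nty => ->; rewrite morph1.
- rewrite -eS; apply: morphim_pHall => //; apply: quotient_pHall sylS.
  by apply/subsetP => g _; apply: norm_dualV.
Qed.

End Concrete.

Local Open Scope group_scope.

Theorem mainTheorem1 (S : {group semidirectT}) (sylS : 2.-Sylow(semidirectG) S) :
  [/\ dualV <| semidirectG, abelian dualV & pi23.-group dualV] /\
  pi_submaximal pi23 semidirectG S /\
  ~ pi_submaximal pi23 (semidirectG / dualV)%G (S / dualV)%G.
Proof.
split; last first.
  by split; [apply: Sylow2_pi_submaximal | apply: quotient_Sylow2_not_pi_submaximal].
split; first exact: dualV_normal.
  exact: abelianS dualV_sub (abelem_abelian translG_abelem).
by rewrite /pgroup card_dualV.
Qed.
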